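(* There is a satisfiable HyperLTL sentence that is not satisfied by any finite set of traces.
   Context: Fix a finite set $AP$ of atomic propositions. A trace over $AP$ is a map $t:\mathbb{N}\to 2^{AP}$. HyperLTL formulas are given by the grammar $\varphi ::= \exists \pi.\ \varphi \mid \forall \pi.\ \varphi \mid \psi$ and $\psi ::= a_\pi \mid \neg\psi \mid \psi\vee\psi \mid \mathbf{X}\psi \mid \psi\,\mathbf{U}\,\psi$, where $a\in AP$ and $\pi$ ranges over a countable set of trace variables. For a set $T$ of traces and a trace assignment $\Pi$ (a partial map from trace variables to traces), with $\Pi[j]$ denoting the assignment mapping each $\pi$ in the domain of $\Pi$ to the suffix $\Pi(\pi)(j)\Pi(\pi)(j+1)\cdots$: $(T,\Pi)\models a_\pi$ iff $a\in\Pi(\pi)(0)$; negation and disjunction are as usual; $(T,\Pi)\models\mathbf{X}\psi$ iff $(T,\Pi[1])\models\psi$; $(T,\Pi)\models\psi_1\mathbf{U}\psi_2$ iff there is $j\ge 0$ with $(T,\Pi[j])\models\psi_2$ and $(T,\Pi[j'])\models\psi_1$ for all $0\le j'<j$; $(T,\Pi)\models\exists\pi.\varphi$ iff there is $t\in T$ with $(T,\Pi[\pi\mapsto t])\models\varphi$; $(T,\Pi)\models\forall\pi.\varphi$ iff this holds for all $t\in T$. A sentence is a formula without free trace variables; $T$ satisfies (is a model of) a sentence $\varphi$ if $(T,\Pi_\emptyset)\models\varphi$ for the empty assignment $\Pi_\emptyset$. A sentence is satisfiable if it has a model. *)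

(* Defs.v *)
From mathcomp Require Import all_boot.
From mathcomp Require Import boolp classical_sets functions cardinality.

Set Implicit Arguments.
Unset Strict Implicit.
Unset Printing Implicit Defensive.

Local Open Scope classical_set_scope.

Definition trace (AP : finType) : Type := nat -> {set AP}.

Definition suffix_from (AP : finType) (j : nat) (t : trace AP) : trace AP :=
  fun i => t (j + i)%N.

(* Trace variables are natural numbers. *)
Definition tvar : Type := nat.

Inductive qfree (AP : finType) : Type :=
| Atom (a : AP) (p : tvar)
| Neg (psi : qfree AP)
| Or (psi1 psi2 : qfree AP)
| Next (psi : qfree AP)
| Until (psi1 psi2 : qfree AP).

Inductive hyperltl (AP : finType) : Type :=
| Exists (p : tvar) (phi : hyperltl AP)
| Forall (p : tvar) (phi : hyperltl AP)
| Matrix (psi : qfree AP).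

Definition assignment (AP : finType) : Type := tvar -> option (trace AP).

Definition empty_assignment (AP : finType) : assignment AP := fun _ => None.

Definition update (AP : finType) (Pi : assignment AP) (p : tvar)
    (t : trace AP) : assignment AP :=
  fun q : nat => if q == p then Some t else Pi q.

Definition shift (AP : finType) (Pi : assignment AP) (j : nat) :
    assignment AP :=
  fun p => omap (suffix_from j) (Pi p).

(* The set of traces is only consulted by the quantifiers, so it is not an
   argument here. An atom at a variable outside the domain of [Pi] gets the
   junk value [False]; this never occurs when evaluating a sentence. *)
Fixpoint qf_sat (AP : finType) (Pi : assignment AP) (psi : qfree AP) : Prop :=
  match psi with
  | Atom a p => if Pi p is Some t then a \in t 0%N else False
  | Neg psi1 => ~ qf_sat Pi psi1
  | Or psi1 psi2 => qf_sat Pi psi1 \/ qf_sat Pi psi2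
  | Next psi1 => qf_sat (shift Pi 1) psi1
  | Until psi1 psi2 =>
      exists j : nat, qf_sat (shift Pi j) psi2 /\
        forall j' : nat, (j' < j)%N -> qf_sat (shift Pi j') psi1
  end.

Fixpoint sat (AP : finType) (T : set (trace AP)) (Pi : assignment AP)
    (phi : hyperltl AP) : Prop :=
  match phi with
  | Exists p phi1 => exists t : trace AP, T t /\ sat T (update Pi p t) phi1
  | Forall p phi1 => forall t : trace AP, T t -> sat T (update Pi p t) phi1
  | Matrix psi => qf_sat Pi psi
  end.

Fixpoint qf_vars (AP : finType) (psi : qfree AP) : set tvar :=
  match psi with
  | Atom _ p => [set p]
  | Neg psi1 => qf_vars psi1
  | Or psi1 psi2 => qf_vars psi1 `|` qf_vars psi2
  | Next psi1 => qf_vars psi1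
  | Until psi1 psi2 => qf_vars psi1 `|` qf_vars psi2
  end.

Fixpoint free_vars (AP : finType) (phi : hyperltl AP) : set tvar :=
  match phi with
  | Exists p phi1 => free_vars phi1 `\` [set p]
  | Forall p phi1 => free_vars phi1 `\` [set p]
  | Matrix psi => qf_vars psi
  end.

Definition sentence (AP : finType) (phi : hyperltl AP) : Prop :=
  free_vars phi = set0.

Definition is_model (AP : finType) (T : set (trace AP)) (phi : hyperltl AP) :
    Prop :=
  sat T (@empty_assignment AP) phi.

Definition satisfiable (AP : finType) (phi : hyperltl AP) : Prop :=
  exists T : set (trace AP), is_model T phi.

(* Main.v *)
(* Let [first t] be the first position of [t] carrying [a]. The matrix
   [~a_2 U (a_1 /\ ~a_2)] forces [first t < first t'] for the trace [t'] chosen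
   for [t], and the quantifier over [t] forces every trace to carry [a]. Hence
   a model contains traces with arbitrarily large [first]. The traces that are
   empty at all positions but one, and full there, form a model. *)
Require Import Defs.
From mathcomp Require Import all_boot.
From mathcomp Require Import boolp classical_sets functions cardinality.

Set Implicit Arguments.
Unset Strict Implicit.
Unset Printing Implicit Defensive.

Local Open Scope classical_set_scope.

(* The outermost quantifier binds an unused variable: it only excludes the empty
   model. *)
Definition unbounded_formula (AP : finType) (a : AP) : hyperltl AP :=
  Exists 0 (Forall 1 (Exists 2 (Matrix
    (Until (Neg (Atom a 2)) (Neg (Or (Neg (Atom a 1)) (Atom a 2))))))).

(** Any occurrence [j] of [a] in [t] may serve, not only the first one, and [t'] may lack [a]
    altogether. *)
Definition later_first (AP : finType) (a : AP) (t t' : trace AP) : Prop :=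
  exists j, a \in t j /\ forall i, (i <= j)%N -> a \notin t' i.

Lemma unbounded_formula_sentence (AP : finType) (a : AP) :
  sentence (unbounded_formula a).
Proof.
rewrite /sentence /=; apply/seteqP; split => // x /=.
by case=> [[[[x2|[x1|x2]] n2] n1] _].
Qed.

Lemma unbounded_formulaP (AP : finType) (a : AP) (T : set (trace AP)) :
  is_model T (unbounded_formula a) <->
  T !=set0 /\ forall t, T t -> exists2 t', T t' & later_first a t t'.
Proof.
rewrite /is_model /= /shift /update /suffix_from /=.
split=> [[t0 [Tt0 H]]|[[t0 Tt0] H]].
  split=> [|t Tt]; first by exists t0.
  have [t' [Tt' [j [tj before_j]]]] := H t Tt.
  exists t' => //; exists j; move: tj; rewrite addn0 => /not_orP[/contrapT tj t'j].
  (* Position [j] is covered by the right argument of the until, the positions before [j] by the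
     left one. *)
  split=> // i; rewrite leq_eqVlt => /predU1P[->|ij]; first exact/negP.
  by have := before_j i ij; rewrite addn0 => /negP.
exists t0; split=> // t Tt; have [t' Tt' [j [tj before_j]]] := H t Tt.
exists t'; split=> //; exists j; rewrite addn0; split.
  by case=> [/(_ tj)//|]; apply/negP/before_j.
by move=> i ij; rewrite addn0; apply/negP/before_j/ltnW.
Qed.

Lemma unbounded_formula_satisfiable (AP : finType) (a : AP) :
  satisfiable (unbounded_formula a).
Proof.
pose full_at n : trace AP := fun i => [set _ : AP | i == n]%SET.
exists (range full_at); apply/unbounded_formulaP; split.
  by exists (full_at 0%N), 0%N.
move=> _ [n _ <-]; exists (full_at n.+1); first by exists n.+1.
exists n; rewrite /full_at inE; split=> // i le_in.
by rewrite inE ltn_eqF.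
Qed.

Lemma finite_image_bounded (T : Type) (A : set T) (f : T -> nat) :
  finite_set A -> exists n, forall x, A x -> (f x <= n)%N.
Proof.
move=> /(finite_image f) /finite_seqP[s fAE].
exists (\max_(i <- s) i)%N => x Ax; apply: leq_bigmax_seq => //.
by have : (f @` A) (f x) by [exists x]; rewrite fAE.
Qed.

Lemma unbounded_formula_no_finite_model (AP : finType) (a : AP)
    (T : set (trace AP)) :
  finite_set T -> ~ is_model T (unbounded_formula a).
Proof.
move=> finT /unbounded_formulaP[[t0 Tt0] next].
have late n : exists2 t, T t & forall i, (i < n)%N -> a \notin t i.
  elim: n => [|n [t Tt before_n]]; first by exists t0.
  have [t' Tt' [j [tj before_j]]] := next t Tt.
  (* Here [n <= j], since [t] carries [a] at [j] but nowhere before [n]; so each step lengthens the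
     [a]-free prefix. *)
  exists t' => // i lt_in; apply: before_j.
  apply: (@leq_trans n) => //; rewrite leqNgt.
  by apply/negP => /before_n; rewrite tj.
(* Each trace of [T] carries [a], being the first argument of some [later_first]. Outside [T] the
   value 0 is a default. *)
have /choice[f occurs] (t : trace AP) : exists j, T t -> a \in t j.
  have [/next[_ _ [j [tj _]]]|nTt] := pselect (T t); first by exists j.
  by exists 0%N.
have [n f_le] := finite_image_bounded f finT.
(* The bound [f t <= n] is not strict, so a prefix of length [n.+1] is taken to contain position
   [f t]. *)
have [t Tt before] := late n.+1.
by move: (before (f t) (f_le t Tt)); rewrite occurs.
Qed.

Theorem theorem1 (AP : finType) (AP_nonempty : (0 < #|AP|)%N) :
  exists phi : hyperltl AP,
    [/\ sentence phi,
        satisfiable phi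
      & forall T : set (trace AP), finite_set T -> ~ is_model T phi].
Proof.
have /card_gt0P[a _] := AP_nonempty.
exists (unbounded_formula a); split.
- exact: unbounded_formula_sentence.
- exact: unbounded_formula_satisfiable.
- exact: unbounded_formula_no_finite_model.
Qed.
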